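(* There exists an absolute constant $c>0$ such that for every finite set $A\subset\mathbb{R}$ with $|A|\ge2$, $$\left|\frac{AA+AA}{A+A}\right| \ \ge\ c\,\frac{|A|^{11/8}|AA|^{3/4}}{\log|A|}.$$ In particular (with an absolute constant $c>0$), $$\left|\frac{AA+AA}{A+A}\right| \ \ge\ c\,\frac{|A|^{2+\frac18}}{\log|A|}.$$
   Context: $AA=\{ab:a,b\in A\}$ and $\frac{AA+AA}{A+A}=\left\{\frac{a_1a_2+a_3a_4}{a_5+a_6}: a_1,\dots,a_6\in A,\ a_5+a_6\neq0\right\}$. Logarithms are base $2$. *)

(* Defs.v *)
From mathcomp Require Import all_boot all_order all_algebra finmap.
From mathcomp Require Import all_classical all_reals all_analysis.

Set Implicit Arguments.
Unset Strict Implicit.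
Unset Printing Implicit Defensive.

Import Order.TTheory GRing.Theory Num.Theory.
Local Open Scope fset_scope.
Local Open Scope ring_scope.

Definition sumset (R : realType) (A B : {fset R}) : {fset R} :=
  [fset a + b | a in A, b in B].

Definition prodset (R : realType) (A B : {fset R}) : {fset R} :=
  [fset a * b | a in A, b in B].

(* Zero denominators are discarded, so the convention x / 0 = 0 plays no role. *)
Definition quotset (R : realType) (A B : {fset R}) : {fset R} :=
  [fset a / b | a in A, b in B & b != 0].

Definition AAAAoverAA (R : realType) (A : {fset R}) : {fset R} :=
  quotset (sumset (prodset A A) (prodset A A)) (sumset A A).

Lemma in_AAAAoverAA (R : realType) (A : {fset R}) (x : R) :
  x \in AAAAoverAA A <->
  exists a1 a2 a3 a4 a5 a6 : R,
    [/\ [/\ a1 \in A, a2 \in A & a3 \in A], [/\ a4 \in A, a5 \in A & a6 \in A],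
        a5 + a6 != 0 & x = (a1 * a2 + a3 * a4) / (a5 + a6)].
Proof.
split.
- case/imfset2P => s /imfset2P[p /imfset2P[a1 A1 [a2 A2 ->]]].
  case=> q /imfset2P[a3 A3 [a4 A4 ->]] -> [d].
  rewrite !inE => /andP[/imfset2P[a5 A5 [a6 A6 ->]] d0] ->.
  by exists a1, a2, a3, a4, a5, a6.
- case=> [a1 [a2 [a3 [a4 [a5 [a6 [[A1 A2 A3] [A4 A5 A6] d0 ->]]]]]]].
  apply: in_imfset2; last by rewrite !inE d0 andbT; apply: in_imfset2.
  by apply: in_imfset2; apply: in_imfset2.
Qed.

Definition log2 (R : realType) (x : R) : R := ln x / ln 2.

(* Main.v *)
Require Import Defs.
From mathcomp Require Import all_boot all_order all_algebra finmap.
From mathcomp Require Import all_classical all_reals all_analysis.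
From mathcomp Require Import ring lra zify.

Import Order.TTheory GRing.Theory Num.Theory.
Set Implicit Arguments.
Unset Strict Implicit.
Local Open Scope fset_scope.
Local Open Scope ring_scope.

(** Write N = |A|, P = |AA| and let Z be the set (AA + AA)/(A + A).  Discarding
0 and replacing A by -A if needed, one may assume that the set B of positive
elements of A contains at least half of A, and the denominators below are sums
of two elements of B.

Consider the points of B x AA, and for a slope l in AA/B let n(l) be the number
of these points on the line y = l x.  If (x, l x) and (y, m y) are two such
points, the slope [wmean l m x y] = (l x + m y)/(x + y) of their sum lies in Z
and lies strictly between l and m.  So, if the slopes are sorted and cut into
clusters of M consecutive ones, distinct clusters produce disjoint parts of Z.

Suppose that all the slopes considered have n(l) >= t.  A pair l < m of slopes
in a cluster produces at least t elements of Z, so a cluster would produce about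
M^2 t elements if different pairs produced mostly different ones, and
[wmean_clusters] shows that this is the case when M^6 is at most about t.  The
number of coincidences between the pairs (l, m) and (l', m') is the number of
solutions of wmean l m x y = wmean l' m' x' y'.  For fixed y and y' this is an
increasing curve in the (x, x')-plane, and it is met with a set of t^2 points in
a Cartesian product.  Two points lie on at most two of the t^2 curves
([card_curves_through]), so the elementary proof of the Szemeredi-Trotter bound
for Cartesian products applies: the product is cut into square cells of s x s
points, an increasing curve meets at most 2t/s + 1 cells, and inside the cells
one counts pairs of points ([wmean_energy_distinct]).  With s = M^2, a set S of
slopes with n(l) >= t yields |S| t M elements of Z up to a constant, and M can
be taken of the order of t^(1/8) ([slopes_growth]).

It remains to find a good t.  The sum of n(l) over all slopes is |B| P, and it
is also the sum over t of |S_t|, where S_t is the set of slopes with n(l) >= t.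
There are at most P^3/N^2 slopes ([card_quot_prodset], from Petridis's form of
Pluennecke's inequality and Ruzsa's triangle inequality), so the t below
t0 = |B| P/(2 |AA/B|), which is at least N^3/(4 P^2), contribute at most half of
this sum.  For t >= t0 the number |S_t| is at most |Z| t0^(-1/8)/t up to a
constant, and summing the harmonic series yields
N P t0^(1/8) <= K |Z| (1 + ln N), hence the lower bound
N^(11/8) P^(3/4)/log N.  The second bound follows since P >= N. *)

(** * Weighted means of two slopes *)

(** The slope of the sum of the points (x, l x) and (y, m y). *)
Definition wmean {R : realType} (l m x y : R) : R := (l * x + m * y) / (x + y).

Lemma wmean_gt (R : realType) (l m x y : R) :
  l < m -> 0 < x -> 0 < y -> l < wmean l m x y.
Proof. by move=> lm x0 y0; rewrite ltr_pdivlMr ?addr_gt0//; nra. Qed.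

Lemma wmean_lt (R : realType) (l m x y : R) :
  l < m -> 0 < x -> 0 < y -> wmean l m x y < m.
Proof. by move=> lm x0 y0; rewrite ltr_pdivrMr ?addr_gt0//; nra. Qed.

Lemma wmeanE (R : realType) (l m x y : R) :
  0 < x -> 0 < y -> wmean l m x y = l + (m - l) * (y / (x + y)).
Proof. by move=> x0 y0; rewrite /wmean; field; rewrite gt_eqF ?addr_gt0. Qed.

Lemma wmean_ltl (R : realType) (l m x1 x2 y : R) : l < m -> 0 < y ->
  0 < x1 -> 0 < x2 -> (wmean l m x2 y < wmean l m x1 y) = (x1 < x2).
Proof.
move=> lm y0 p1 p2; rewrite !wmeanE// ltrD2l ltr_pM2l ?subr_gt0//.
by rewrite ltr_pM2l// ltf_pV2 ?posrE ?addr_gt0// ltrD2r.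
Qed.

Lemma wmean_injr (R : realType) (l m x y1 y2 : R) : l < m -> 0 < x ->
  0 < y1 -> 0 < y2 -> wmean l m x y1 = wmean l m x y2 -> y1 = y2.
Proof.
move=> lm x0 p1 p2; rewrite !wmeanE// => /addrI /mulfI.
have ml0 : m - l != 0 by rewrite subr_eq0 gt_eqF.
move=> /(_ ml0)/eqP.
have u1 : x + y1 != 0 by rewrite gt_eqF ?addr_gt0.
have u2 : x + y2 != 0 by rewrite gt_eqF ?addr_gt0.
rewrite eqr_div// => /eqP H.
by apply: (@mulIf _ x); [rewrite gt_eqF|lra].
Qed.

(** Once y and y' are fixed, the solutions (x, x') of
wmean l m x y = wmean l' m' x' y' form an increasing curve, because both sides
decrease in their third argument. *)
Lemma wmean_eq_lt (R : realType) (l m l' m' x1 x2 y x1' x2' y' : R) :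
  l < m -> l' < m' -> 0 < y -> 0 < y' -> 0 < x1 -> 0 < x2 -> 0 < x1' -> 0 < x2' ->
  wmean l m x1 y = wmean l' m' x1' y' -> wmean l m x2 y = wmean l' m' x2' y' ->
  (x1 < x2) = (x1' < x2').
Proof.
move=> lm lm' y0 y0' p1 p2 p1' p2' e1 e2.
by rewrite -(@wmean_ltl _ l m x1 x2 y)// e1 e2 wmean_ltl.
Qed.

(** A map with few collisions has a large image.  If n_w is the number of
preimages of w, summing 2 a n_w <= n_w^2 + a^2 over w in W replaces the
Cauchy-Schwarz inequality.  It is used with a = 1, where it says that a set
exceeding its image produces pairs in a common fibre, and with a proportional to
the average number of collisions of a point. *)
Lemma collision_bound (X : finType) (Y : eqType) (D : {set X}) (f : X -> Y)
    (W : seq Y) (a : nat) :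
  (forall x, x \in D -> f x \in W) ->
  (2 * a * #|D| <= \sum_(x in D) \sum_(y in D) (f x == f y) + a ^ 2 * size W)%N.
Proof.
move=> fW.
pose n w := (\sum_(x in D) (f x == w))%N.
have one x : x \in D -> (\sum_(w <- undup W) (f x == w) = 1)%N.
  move=> xD; rewrite (bigD1_seq (f x)) ?undup_uniq ?mem_undup ?fW//= eqxx.
  by rewrite big1// => w; rewrite eq_sym => /negPf->.
have -> : #|D| = (\sum_(w <- undup W) n w)%N.
  by rewrite exchange_big/= -sum1_card; apply: eq_bigr => x xD; rewrite one.
have -> : (\sum_(x in D) \sum_(y in D) (f x == f y) =
           \sum_(w <- undup W) n w ^ 2)%N.
  transitivity (\sum_(x in D) \sum_(y in D) \sum_(w <- undup W)
                  (f x == w) * (f y == w))%N.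
    apply: eq_bigr => x xD; apply: eq_bigr => y yD.
    rewrite (bigD1_seq (f x)) ?undup_uniq ?mem_undup ?fW//= eqxx mul1n.
    rewrite big1 ?addn0; first by rewrite eq_sym.
    by move=> w; rewrite eq_sym => /negPf->.
  under eq_bigr do rewrite exchange_big/=.
  rewrite exchange_big/=; apply: eq_bigr => w _.
  by rewrite expnS expn1 big_distrl/=; apply: eq_bigr => x _; rewrite big_distrr.
apply: (@leq_trans (\sum_(w <- undup W) (n w ^ 2 + a ^ 2))%N).
  rewrite big_distrr/=; apply: leq_sum => w _.
  by rewrite -mulnA addnC; exact: (nat_Cauchy a (n w)).1.
rewrite big_split/= leq_add2l big_const_seq count_predT iter_addn_0.
by rewrite leq_mul2l size_undup orbT.
Qed.

Lemma card_block (t s c : nat) : (0 < s)%N ->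
  (\sum_(i < t) ((i %/ s)%N == c) <= s)%N.
Proof.
move=> s0; have -> : (\sum_(i < t) ((i %/ s)%N == c) =
    #|[set i : 'I_t | (i %/ s)%N == c]|)%N.
  rewrite -sum1_card [RHS]big_mkcond/=; apply: eq_bigr => i _.
  by rewrite inE; case: eqP.
rewrite -[X in (_ <= X)%N]card_ord.
pose h (i : 'I_t) : 'I_s := Ordinal (ltn_pmod i s0).
apply: (@leq_card_in _ _ h) => i j.
rewrite !inE => /eqP ei /eqP ej /(congr1 val)/= e.
by apply: val_inj; rewrite /= (divn_eq i s) (divn_eq j s) ei ej e.
Qed.

(** Two points lie on at most two curves.  For a curve with parameters (y, y'),
y determines y', and y is a root of a polynomial of degree at most 2.  The point
is that this polynomial does not vanish identically: its outer coefficients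
vanish only if ga * al = 0 and de * be = 0 (as x1' <> x2'), and then
al * de - be * ga = (m - l) * (m' - l') > 0 together with (l, m) <> (l', m')
leaves the case al = de = 0, where the middle coefficient is a nonzero multiple
of x1 x1' - x2 x2', which is nonzero because curves are increasing. *)
Lemma card_curves_through (R : realType) (t : nat) (l m l' m' x1 x2 x1' x2' : R)
    (b b' : 'I_t -> R) :
  l < m -> l' < m' -> (l, m) != (l', m') ->
  injective b -> injective b' -> (forall j, 0 < b j) -> (forall j, 0 < b' j) ->
  0 < x1 -> 0 < x2 -> 0 < x1' -> 0 < x2' -> (x1, x1') != (x2, x2') ->
  (\sum_(j < t) \sum_(k < t)
    ((wmean l m x1 (b j) == wmean l' m' x1' (b' k)) &&
     (wmean l m x2 (b j) == wmean l' m' x2' (b' k))) <= 2)%N.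
Proof.
move=> lm lm' neq bI bI' b0 b0' p1 p2 p1' p2' xneq.
pose al := m' - l; pose be := m' - m; pose ga := l - l'; pose de := m - l'.
(* Eliminating y' between the equations of the two curves leaves a quadratic
equation in y, with these coefficients. *)
pose cs : seq R := [:: ga * al * x1 * x2 * (x1' - x2');
   x1' * (de * al * x2 + ga * be * x1) - x2' * (de * al * x1 + ga * be * x2);
   de * be * (x1' - x2')].
pose p : {poly R} := Poly cs.
pose Q j k := (wmean l m x1 (b j) == wmean l' m' x1' (b' k)) &&
     (wmean l m x2 (b j) == wmean l' m' x2' (b' k)).
have rel x x' y y' : 0 < x -> 0 < x' -> 0 < y -> 0 < y' ->
    wmean l m x y = wmean l' m' x' y' ->
    y' * (al * x + be * y) = x' * (de * y + ga * x).
  move=> x0 x0' y0 y0' /eqP.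
  have u1 : x + y != 0 by rewrite gt_eqF ?addr_gt0.
  have u2 : x' + y' != 0 by rewrite gt_eqF ?addr_gt0.
  rewrite /wmean eqr_div// => /eqP e.
  by rewrite /al /be /ga /de; lra.
have rootp j k : Q j k -> root p (b j).
  case/andP=> /eqP/(rel _ _ _ _ p1 p1' (b0 j) (b0' k)) e1.
  move=> /eqP/(rel _ _ _ _ p2 p2' (b0 j) (b0' k)) e2.
  rewrite /root horner_Poly/= mul0r add0r; apply/eqP.
  have : x1' * (de * b j + ga * x1) * (al * x2 + be * b j)
       = x2' * (de * b j + ga * x2) * (al * x1 + be * b j).
    by rewrite -e1 -e2; ring.
  by move=> /eqP; rewrite -subr_eq0 => /eqP e; rewrite -[RHS]e; ring.
pose J := [set j | [exists k, Q j k]].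
have sumJ : (\sum_(j < t) \sum_(k < t) Q j k <= #|J|)%N.
  rewrite -sum1_card big_mkcond/= [leqRHS]big_mkcond/=.
  apply: leq_sum => j _; rewrite inE; case: existsP => [[k Qk]|nk].
    rewrite (bigD1 k)//= Qk big1// => k' kk'; apply/eqP; rewrite eqb0.
    apply: contra kk' => /andP[/eqP e1' _]; case/andP: Qk => /eqP e1 _.
    apply/eqP/bI'/(@wmean_injr _ l' m' x1'); rewrite ?b0'//.
    by rewrite -e1 -e1'.
  rewrite big1// => k _; apply/eqP; rewrite eqb0.
  by apply/negP => ?; apply: nk; exists k.
apply: leq_trans sumJ _.
have [->|[j0]] := set_0Vmem J; first by rewrite cards0.
rewrite inE => /existsP[k0 /andP[/eqP f1 /eqP f2]].
have mono1 : (x1 < x2) = (x1' < x2') by apply: wmean_eq_lt f1 f2.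
have mono2 : (x2 < x1) = (x2' < x1') by apply: wmean_eq_lt f2 f1.
have pn0 : p != 0.
  apply/eqP => p0.
  have coef0 k : cs`_k = 0 by rewrite -(coef_Poly cs) -/p p0 coef0.
  have c0 : ga * al * x1 * x2 * (x1' - x2') = 0 := coef0 0%N.
  have c1 : x1' * (de * al * x2 + ga * be * x1) -
      x2' * (de * al * x1 + ga * be * x2) = 0 := coef0 1%N.
  have c2 : de * be * (x1' - x2') = 0 := coef0 2%N.
  have det : 0 < al * de - be * ga.
    have -> : al * de - be * ga = (m - l) * (m' - l') by rewrite /al /be /ga /de; ring.
    by rewrite mulr_gt0 ?subr_gt0.
  have d' : x1' - x2' != 0 /\ x1 * x1' - x2 * x2' != 0.
    case: (ltgtP x1 x2) => [h|h|h].
    - have h' : x1' < x2' by rewrite -mono1.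
      by split; rewrite lt_eqF ?subr_lt0//; apply: ltr_pM => //; exact: ltW.
    - have h' : x2' < x1' by rewrite -mono2.
      by split; rewrite gt_eqF ?subr_gt0//; apply: ltr_pM => //; exact: ltW.
    - move: xneq mono1 mono2; rewrite h ltxx xpair_eqE eqxx/=.
      by case: ltgtP.
  case: d' => d1 d2.
  have gaal : ga * al = 0.
    move/eqP: c0; rewrite !mulf_eq0 (negPf d1) (gt_eqF p1) (gt_eqF p2) !orbF.
    by move=> H; apply/eqP; rewrite mulf_eq0.
  have debe : de * be = 0 by move/eqP: c2; rewrite mulf_eq0 (negPf d1) orbF => /eqP.
  have [be0|be0] := eqVneq be 0.
    have ga0 : ga != 0.
      apply: contra neq => /eqP g0; rewrite xpair_eqE.
      by move: g0 be0 => /eqP; rewrite /ga /be !subr_eq0 => /eqP-> /eqP;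
        rewrite subr_eq0 => /eqP->; rewrite !eqxx.
    move/eqP: gaal; rewrite mulf_eq0 (negPf ga0)/= => /eqP al0.
    by move: det; rewrite be0 al0 !mul0r subrr ltxx.
  move/eqP: debe; rewrite mulf_eq0 (negPf be0) orbF => /eqP de0.
  have ga0 : ga != 0 by apply/eqP => g0; move: det; rewrite de0 g0 !mulr0 subrr ltxx.
  have : ga * be * (x1 * x1' - x2 * x2') = 0 by rewrite -c1 de0; ring.
  by move/eqP; rewrite !mulf_eq0 (negPf ga0) (negPf be0) (negPf d2).
have : (size [seq b j | j <- enum J] < size p)%N.
  apply: max_poly_roots => //.
    apply/allP => y /mapP[j]; rewrite mem_enum inE => /existsP[k] /rootp rj ->.
    exact: rj.
  by rewrite map_inj_uniq ?enum_uniq.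
rewrite size_map -cardE => /leq_trans/(_ (size_Poly _))/=.
by rewrite ltnS.
Qed.

(** A Szemeredi-Trotter bound for the Cartesian product of the ranges of a and
a'.  The pairs c = (j, k) of indices of b and b' label t^2 curves.  The function
g numbers the cells of side s along diagonals: two points of an increasing curve
in the same diagonal are in the same cell, and g takes at most 2 (t %/ s) + 1
values.  So a curve carrying many points carries many pairs of points in a
common cell; there are at most t^2 s^2 such pairs in total, and each of them is
on at most two curves. *)
Lemma wmean_energy_distinct (R : realType) (t s : nat) (l m l' m' : R)
    (a b a' b' : 'I_t -> R) :
  (0 < s)%N -> l < m -> l' < m' -> (l, m) != (l', m') ->
  {homo a : i j / (i < j)%N >-> i < j} -> {homo a' : i j / (i < j)%N >-> i < j} ->
  injective b -> injective b' ->
  (forall i, 0 < a i) -> (forall i, 0 < b i) ->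
  (forall i, 0 < a' i) -> (forall i, 0 < b' i) ->
  (\sum_(p : 'I_t * 'I_t) \sum_(q : 'I_t * 'I_t)
     (wmean l m (a p.1) (b p.2) == wmean l' m' (a' q.1) (b' q.2))
   <= t ^ 2 * (2 * (t %/ s) + 1 + 2 * s ^ 2))%N.
Proof.
move=> s0 lm lm' neq aM aM' bI bI' a0 b0 a0' b0'.
pose T : finType := ('I_t * 'I_t)%type.
pose inc (c p : T) := wmean l m (a p.1) (b c.1) == wmean l' m' (a' p.2) (b' c.2).
have -> : (\sum_(p : T) \sum_(q : T)
     (wmean l m (a p.1) (b p.2) == wmean l' m' (a' q.1) (b' q.2))
   = \sum_(c : T) \sum_(p : T) inc c p)%N.
  rewrite 2!pair_big/=.
  pose h (z : T * T) : T * T := ((z.1.2, z.2.2), (z.1.1, z.2.1)).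
  rewrite [RHS](reindex_inj (h := h))/=; first by apply: eq_bigr.
  by move=> [[? ?] [? ?]] [[? ?] [? ?]]; rewrite /h/= => -[-> -> -> ->].
pose cell (p q : T) := ((p.1 %/ s == q.1 %/ s) && (p.2 %/ s == q.2 %/ s))%N.
pose D c : {set T} := [set p | inc c p].
pose g (p : T) := (p.1 %/ s + p.2 %/ s)%N.
have aW : {homo a : i j / (i <= j)%N >-> i <= j}.
  by move=> i j; rewrite leq_eqVlt => /orP[/eqP/val_inj->//|/aM/ltW].
have aMono i j : (a i < a j) = (i < j)%N.
  by case: ltnP => [/aM//|/aW]; case: ltP.
have aW' : {homo a' : i j / (i <= j)%N >-> i <= j}.
  by move=> i j; rewrite leq_eqVlt => /orP[/eqP/val_inj->//|/aM'/ltW].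
have aMono' i j : (a' i < a' j) = (i < j)%N.
  by case: ltnP => [/aM'//|/aW']; case: ltP.
have chain c p q : inc c p -> inc c q -> (p.1 < q.1)%N = (p.2 < q.2)%N.
  move=> /eqP ip /eqP iq; rewrite -aMono -aMono'.
  exact: (wmean_eq_lt lm lm' (b0 _) (b0' _) (a0 _) (a0 _) (a0' _) (a0' _) ip iq).
have same c p q : inc c p -> inc c q -> g p = g q -> cell p q.
  move=> ip iq; rewrite /g /cell => e.
  have [h|h] := leqP p.1 q.1.
    have := leq_div2r s h.
    have : (p.2 <= q.2)%N by rewrite leqNgt -(chain _ _ _ iq ip) -leqNgt.
    by move=> /(leq_div2r s); lia.
  have := leq_div2r s (ltnW h).
  have : (q.2 <= p.2)%N by rewrite ltnW// -(chain _ _ _ iq ip).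
  by move=> /(leq_div2r s); lia.
(* Points of the curve c: one for each value of g, then pairs in a cell. *)
have few c : (\sum_p inc c p <= 2 * (t %/ s) + 1 +
    \sum_p \sum_q (p != q) * cell p q * (inc c p * inc c q))%N.
  have -> : (\sum_p inc c p = #|D c|)%N.
    rewrite -sum1_card [RHS]big_mkcond/=; apply: eq_bigr => p _.
    by rewrite inE; case: (inc c p).
  have gin p : p \in D c -> g p \in iota 0 (2 * (t %/ s) + 1).
    rewrite mem_iota /= add0n /g => _.
    have := leq_div2r s (ltnW (ltn_ord p.1)); have := leq_div2r s (ltnW (ltn_ord p.2)).
    lia.
  have := @collision_bound _ _ (D c) g _ 1%N gin.
  rewrite size_iota exp1n mul1n muln1.
  suff : (\sum_(p in D c) \sum_(q in D c) (g p == g q) <=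
     #|D c| + \sum_p \sum_q (p != q) * cell p q * (inc c p * inc c q))%N by lia.
  rewrite -sum1_card [X in (_ <= X + _)%N]big_mkcond/= [leqLHS]big_mkcond/= -big_split/=.
  apply: leq_sum => p _; rewrite inE; case ip: (inc c p) => //.
  rewrite [leqLHS]big_mkcond/= (bigD1 p)//= inE ip eqxx.
  rewrite leq_add2l [leqRHS](bigD1 p)//= eqxx !mul0n add0n.
  apply: leq_sum => q qp; rewrite inE; case iq: (inc c q) => //.
  rewrite (eq_sym p) qp; case: eqP => // /(same c _ _ ip iq) ->//.
apply: (@leq_trans (\sum_(c : T) (2 * (t %/ s) + 1 +
    \sum_p \sum_q (p != q) * cell p q * (inc c p * inc c q)))%N).
  by apply: leq_sum => c _; exact: few.
have cT : #|T| = (t ^ 2)%N by rewrite card_prod card_ord mulnn.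
rewrite big_split/= sum_nat_const cT [leqRHS]mulnDr leq_add2l.
rewrite exchange_big/=.
apply: (@leq_trans (\sum_(p : T) (2 * s ^ 2))%N); last by rewrite sum_nat_const cT.
apply: leq_sum => p _; rewrite exchange_big/=.
apply: (@leq_trans (\sum_(q : T) cell p q * 2)%N).
  apply: leq_sum => q _; rewrite -big_distrr/=.
  have [->|pq] := eqVneq p q; first by rewrite mul0n.
  rewrite mul1n leq_mul2l; apply/orP; right.
  have := @card_curves_through R t l m l' m' (a p.1) (a q.1) (a' p.2) (a' q.2) b b'.
  move=> /(_ lm lm' neq bI bI' b0 b0' (a0 _) (a0 _) (a0' _) (a0' _)).
  have ne : (a p.1, a' p.2) != (a q.1, a' q.2).
    apply: contra pq; rewrite xpair_eqE => /andP[/eqP e1 /eqP e2].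
    case: p q e1 e2 => [p1 p2] [q1 q2]/= e1 e2; rewrite xpair_eqE.
    have := aMono p1 q1; have := aMono q1 p1; have := aMono' p2 q2; have := aMono' q2 p2.
    rewrite e1 e2 !ltxx -!val_eqE/=; lia.
  move=> /(_ ne); rewrite pair_big/=; apply: leq_trans.
  by apply: leq_sum => c _; rewrite mulnb.
rewrite -big_distrl/= mulnC leq_mul2l/=.
rewrite -(pair_big xpredT xpredT (fun i j => nat_of_bool (cell p (i, j))))/=.
apply: (@leq_trans (\sum_(i < t) (i %/ s == p.1 %/ s) * s)%N).
  apply: leq_sum => i _; rewrite /cell/= eq_sym.
  case: eqP => [_|_]; last by rewrite big1.
  rewrite /= mul1n; under eq_bigr do rewrite /= eq_sym.
  exact: card_block.
by rewrite -big_distrl/= expnS expn1 leq_mul2r card_block ?orbT.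
Qed.

Lemma wmean_energy_same (R : realType) (t : nat) (l m : R) (a b : 'I_t -> R) :
  l < m -> injective b -> (forall i, 0 < a i) -> (forall i, 0 < b i) ->
  (\sum_(p : 'I_t * 'I_t) \sum_(q : 'I_t * 'I_t)
     (wmean l m (a p.1) (b p.2) == wmean l m (a q.1) (b q.2)) <= t ^ 3)%N.
Proof.
move=> lm bI a0 b0.
have -> : (t ^ 3 = \sum_(p : 'I_t * 'I_t) \sum_(i < t) 1)%N.
  by rewrite !sum_nat_const card_prod !card_ord muln1 !expnS muln1 mulnA.
apply: leq_sum => p _.
rewrite -(pair_big xpredT xpredT (fun i j => nat_of_bool
  (wmean l m (a p.1) (b p.2) == wmean l m (a i) (b j))))/=.
apply: leq_sum => i _.
case: (pickP (fun j => wmean l m (a p.1) (b p.2) == wmean l m (a i) (b j))) => [j /eqP e|none].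
  rewrite (bigD1 j)//= e eqxx big1// => k; apply: contraNeq.
  rewrite eqb0 negbK => /eqP/wmean_injr e'.
  by apply/eqP/bI; rewrite e'.
by rewrite big1// => k _; rewrite none.
Qed.

(** Each cluster c has M slopes [sg c u], and each slope carries t points, with
abscissas [e c u i].  The map f sends a pair of slopes in a cluster and a pair of
points on them to an element of Z; the collisions of f between different clusters
do not exist, and inside a cluster they are bounded by the energies above with
s = M ^ 2.  The hypothesis on M makes the collisions between different pairs of
slopes as rare as those within a pair, for which t^3 is the trivial bound. *)
Lemma wmean_clusters (R : realType) (m M t : nat) (sg : 'I_m -> 'I_M -> R)
    (e : 'I_m -> 'I_M -> 'I_t -> R) (Z : {fset R}) :
  (2 <= M)%N -> (M ^ 6 <= 64 * t)%N ->
  (forall c, {homo sg c : u v / (u < v)%N >-> u < v}) ->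
  (forall (c d : 'I_m) u v, (c < d)%N -> sg c u < sg d v) ->
  (forall c u, {homo e c u : i j / (i < j)%N >-> i < j}) ->
  (forall c u i, 0 < e c u i) ->
  (forall c u v i j, wmean (sg c u) (sg c v) (e c u i) (e c v j) \in Z) ->
  (m * 'C(M, 2) * t <= 135 * #|` Z|)%N.
Proof.
move=> M2 M6 sgM sgC eM e0 inZ.
have [->|t0] := posnP t; first by rewrite muln0.
pose T : finType := ('I_t * 'I_t)%type.
pose K : finType := ('I_m * ('I_M * 'I_M))%type.
pose J : {set K} := [set k : K | (k.2.1 < k.2.2)%N].
have cJ : #|J| = (m * 'C(M, 2))%N.
  have -> : J = finset.setX [set: 'I_m] [set w : 'I_M * 'I_M | (w.1 < w.2)%N].
    by apply/setP => k; rewrite !inE.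
  rewrite cardsX cardsT card_ord; congr (_ * _)%N.
  have -> : (#|[set w : 'I_M * 'I_M | (w.1 < w.2)%N]| =
      \sum_(i < M) \sum_(j < M) (i < j))%N.
    rewrite -sum1_card big_mkcond/= pair_big/=; apply: eq_bigr => -[i j] _.
    by rewrite inE/=; case: ltnP.
  rewrite exchange_big/= -triangular_sum big_mkord; apply: eq_bigr => j _.
  transitivity (\sum_(i < M | (i < j)%N) 1)%N.
    by rewrite [RHS]big_mkcond/=; apply: eq_bigr => i _; case: ltnP.
  rewrite -(big_ord_widen _ (fun=> 1%N) (ltnW (ltn_ord j))).
  by rewrite sum1_card card_ord.
pose f (x : K * T) := wmean (sg x.1.1 x.1.2.1) (sg x.1.1 x.1.2.2)
   (e x.1.1 x.1.2.1 x.2.1) (e x.1.1 x.1.2.2 x.2.2).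
pose D : {set K * T} := finset.setX J [set: T].
have cT : #|T| = (t ^ 2)%N by rewrite card_prod card_ord mulnn.
have cD : #|D| = (#|J| * t ^ 2)%N by rewrite cardsX cardsT cT.
have fZ x : x \in D -> f x \in (Z : seq R) by move=> _; exact: inZ.
have := @collision_bound _ _ D f Z (135 * t) fZ.
suff E : (\sum_(x in D) \sum_(y in D) (f x == f y) <= 135 * t * #|D|)%N.
  move=> H.
  move: H; rewrite -mulnA mul2n -addnn => /leq_trans/(_ (leq_add E (leqnn _))).
  rewrite leq_add2l cD -cJ; move: t0; clear; move: #|J| #|` Z| => w z t0 H.
  rewrite -(@leq_pmul2l (135 * t * t)%N); last by rewrite !muln_gt0 t0.
  have -> : (135 * t * t * (w * t) = 135 * t * (w * t ^ 2))%N by ring.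
  by have -> : (135 * t * t * (135 * z) = (135 * t) ^ 2 * z)%N by ring.

have sumD (F : K * T -> nat) :
    (\sum_(x in D) F x = \sum_(k in J) \sum_(p : T) F (k, p))%N.
  rewrite (pair_big (mem J) xpredT (fun k p => F (k, p)))/=.
  by apply: eq_big => [[k p]|[k p] _]//; rewrite !inE.
pose B := (t ^ 2 * (2 * (t %/ M ^ 2) + 1 + 2 * (M ^ 2) ^ 2))%N.
have inj_of (k : nat) (h : 'I_k -> R) : {homo h : i j / (i < j)%N >-> i < j} -> injective h.
  move=> hM i j hij; apply: val_inj.
  by case: (ltngtP i j) => // /hM; rewrite hij ltxx.
(* The two terms are for collisions within a pair of slopes, and between two
pairs of the same cluster. *)
have G k k' : k \in J -> k' \in J ->
    (\sum_(p : T) \sum_(q : T) (f (k, p) == f (k', q)) <=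
      (k == k') * t ^ 3 + (k'.1 == k.1) * B)%N.
  case: k k' => [c [u v]] [c' [u' v']]; rewrite !inE /f/= => uv uv'.
  have [ecc|ncc] := eqVneq c' c; last first.
    rewrite big1// => p _; rewrite big1// => q _.
    have b1 := wmean_gt (sgM c _ _ uv) (e0 c u p.1) (e0 c v p.2).
    have b2 := wmean_lt (sgM c _ _ uv) (e0 c u p.1) (e0 c v p.2).
    have b1' := wmean_gt (sgM c' _ _ uv') (e0 c' u' q.1) (e0 c' v' q.2).
    have b2' := wmean_lt (sgM c' _ _ uv') (e0 c' u' q.1) (e0 c' v' q.2).
    case: (ltngtP c c') => [cc|cc|/val_inj cc]; last by rewrite cc eqxx in ncc.
      by rewrite lt_eqF// (lt_trans b2)// (lt_trans _ b1')// sgC.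
    by rewrite gt_eqF// (lt_trans b2')// (lt_trans _ b1)// sgC.
  rewrite {c'}ecc mul1n; have [[<- <-]|ne] := eqVneq (c, (u, v)) (c, (u', v')).
    rewrite mul1n; apply: leq_trans (leq_addr _ _).
    by apply: (wmean_energy_same (a := e c u) (b := e c v)) => //; [exact: sgM|exact: inj_of].
  rewrite mul0n add0n; apply: (wmean_energy_distinct (a := e c u) (b := e c v)
    (a' := e c u') (b' := e c v')) => //; try exact: sgM; try exact: inj_of.
    by rewrite expn_gt0; lia.
  apply: contra ne; rewrite !xpair_eqE eqxx/= => /andP[/eqP h1 /eqP h2].
  by rewrite (inj_of _ _ (sgM c) _ _ h1) (inj_of _ _ (sgM c) _ _ h2) !eqxx.
rewrite sumD cD.
apply: (@leq_trans (\sum_(k in J) (t ^ 3 + M ^ 2 * B))%N); last first.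
  rewrite sum_nat_const mulnCA leq_mul2l; apply/orP; right.
  have h1 : (M ^ 2 * (t %/ M ^ 2) <= t)%N by rewrite mulnC leq_trunc_div.
  have h2 : (2 ^ 4 <= M ^ 4)%N by rewrite leq_exp2r.
  have h3 : (M ^ 2 * M ^ 4 <= 64 * t)%N by rewrite -expnD.
  rewrite /B -!expnM/=; move: h1 h2 h3; clear; set z := (t %/ _)%N.
  rewrite (_ : (t ^ 3 = t ^ 2 * t)%N); last by rewrite -expnSr.
  move: (M ^ 2)%N (M ^ 4)%N (t ^ 2)%N => M2 M4 tt h1 h2 h3.
  have h4 : (M2 <= 4 * t)%N by nia.
  (* The terms t, 2 t, 4 t and 128 t add up to 135 t. *)
  have key : (t + M2 * (2 * z + 1 + 2 * M4) <= 135 * t)%N.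
    by rewrite !mulnDr; lia.
  have := leq_mul (leqnn tt) key. lia.
apply: leq_sum => k kJ.
under eq_bigr do rewrite sumD.
rewrite exchange_big/=.
apply: (@leq_trans (\sum_(k' in J) ((k == k') * t ^ 3 + (k'.1 == k.1) * B))%N).
  by apply: leq_sum => k' k'J; exact: G.
rewrite big_split/= leq_add//.
  rewrite (bigD1 k)//= eqxx mul1n big1 ?addn0// => k' /andP[_]; rewrite eq_sym.
  by move=> /negPf->.
rewrite -big_distrl/= leq_mul2r; apply/orP; right.
apply: (@leq_trans (\sum_(k' : K) (k'.1 == k.1))%N).
  by rewrite big_mkcond/=; apply: leq_sum => k' _; case: ifP.
rewrite -(pair_big xpredT xpredT (fun c (w : 'I_M * 'I_M) => nat_of_bool (c == k.1)))/=.
rewrite (bigD1 k.1)//= eqxx sum_nat_const card_prod card_ord muln1 mulnn.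
rewrite big1 ?addn0// => c /negPf->; exact: big1.
Qed.

(** * From rich slopes to many quotients *)

Definition line_fibre {R : realType} (B P : {fset R}) (l : R) : {fset R} :=
  [fset x in B | l * x \in P].

Lemma nth_sort_fset_lt (R : realType) (S : {fset R}) (i j : nat) :
  (i < j < #|` S|)%N -> nth 0 (sort <=%R S) i < nth 0 (sort <=%R S) j.
Proof.
move=> /andP[ij jS]; rewrite lt_sorted_ltn_nth// ?inE ?size_sort//.
  by rewrite sort_lt_sorted fset_uniq.
exact: ltn_trans jS.
Qed.

Lemma nth_sort_fset_in (R : realType) (S : {fset R}) (i : nat) :
  (i < #|` S|)%N -> nth 0 (sort <=%R S) i \in S.
Proof. by move=> iS; rewrite -(mem_sort <=%R) mem_nth// size_sort. Qed.

(** The slopes of S are sorted and cut into clusters of M consecutive ones; at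
most M - 1 of them are left over, which is at most half of S.  Together with
M^2 <= 4 * 'C(M, 2), this accounts for the factor 1080 / 135 = 8. *)
Lemma slopes_clusters (R : realType) (B P S : {fset R}) (t M : nat) :
  (forall x, x \in B -> 0 < x) ->
  (forall l, l \in S -> (t <= #|` line_fibre B P l|)%N) ->
  (2 <= M)%N -> (M ^ 6 <= 64 * t)%N -> (M <= #|` S|)%N ->
  (#|` S| * M * t <= 1080 * #|` quotset (sumset P P) (sumset B B)|)%N.
Proof.
move=> B0 St M2 M6 MS.
pose m := (#|` S| %/ M)%N.
pose sg (c : 'I_m) (u : 'I_M) := nth 0 (sort <=%R S) (c * M + u).
pose e c u (i : 'I_t) := nth 0 (sort <=%R (line_fibre B P (sg c u))) i.
have idx (c : 'I_m) (u : 'I_M) : (c * M + u < #|` S|)%N.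
  apply: (@leq_trans (m * M)%N); last exact: leq_trunc_div.
  apply: (@leq_trans (c * M + M)%N); first by rewrite ltn_add2l.
  by rewrite addnC -mulSn leq_mul2r ltn_ord orbT.
have sgS c u : sg c u \in S by apply: nth_sort_fset_in.
have eF c u i : e c u i \in line_fibre B P (sg c u).
  by apply: nth_sort_fset_in; apply: leq_trans (St _ (sgS c u)).
have e0 c u i : 0 < e c u i.
  by apply: B0; have := eF c u i; rewrite !inE => /andP[].
have := @wmean_clusters R m M t sg e (quotset (sumset P P) (sumset B B)) M2 M6.
have q1 (c : 'I_m) : {homo sg c : u v / (u < v)%N >-> u < v}.
  by move=> u v uv; apply: nth_sort_fset_lt; rewrite ltn_add2l uv idx.
have q2 (c d : 'I_m) u v : (c < d)%N -> sg c u < sg d v.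
  move=> cd; apply: nth_sort_fset_lt; rewrite idx andbT.
  apply: (@leq_trans (c * M + M)%N); first by rewrite ltn_add2l.
  by rewrite addnC -mulSn (leq_trans _ (leq_addr _ _))// leq_mul2r cd orbT.
have q3 c u : {homo e c u : i j / (i < j)%N >-> i < j}.
  move=> i j ij; apply: nth_sort_fset_lt; rewrite ij/=.
  exact: leq_trans (St _ (sgS c u)).
move=> /(_ q1 q2 q3 e0).
have q4 c u v i j :
    wmean (sg c u) (sg c v) (e c u i) (e c v j) \in quotset (sumset P P) (sumset B B).
  have := eF c u i; have := eF c v j; rewrite !inE => /andP[Bj Pj] /andP[Bi Pi].
  apply: in_imfset2; first exact: in_imfset2.
  by rewrite !inE in_imfset2//= gt_eqF// addr_gt0.
move=> /(_ q4) H.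
have hb : (M * M.-1 = 2 * 'C(M, 2))%N.
  by have := bin_ffact M 2; rewrite !ffactnS ffactn0 muln1 mulnC factS => <-.
have hS : (#|` S| <= 2 * (m * M))%N.
  have m0 : (0 < m)%N by rewrite divn_gt0// ltnW.
  have := divn_eq #|` S| M; have := ltn_pmod #|` S| (ltnW M2); rewrite -/m.
  nia.
have hM : (M * M <= 4 * 'C(M, 2))%N by nia.
move: H hS hM; clear; set b := 'C(M, 2); set z := #|` _|; set n := #|` S|.
move=> H hS hM.
have h1 : (n * M * t <= 2 * (m * M) * M * t)%N by rewrite !leq_mul2r hS !orbT.
have h2 : (2 * (m * M) * M * t <= 8 * (m * b * t))%N.
  rewrite (_ : 2 * (m * M) * M * t = 2 * m * t * (M * M))%N; last by ring.
  rewrite (_ : 8 * (m * b * t) = 2 * m * t * (4 * b))%N; last by ring.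
  by rewrite leq_mul2l hM orbT.
lia.
Qed.

(** The previous lemma with M = 2 max(1, tau) rounded down, so that M^8 <= 256 t,
and hence M^6 <= 64 t.  The factor 2 ensures that M >= 2, so that clusters contain pairs of slopes, also for small t; the only case
where S may be smaller than a cluster is |S| = t = 1. *)
Lemma slopes_growth (R : realType) (B P S : {fset R}) (t : nat) (tau : R) :
  (0 < t)%N -> (forall x, x \in B -> 0 < x) ->
  (forall l, l \in S -> (t <= #|` line_fibre B P l|)%N) ->
  (t <= #|` S|)%N -> tau ^+ 8 <= t%:R ->
  #|` S|%:R * t%:R * tau <= 1080 * #|` quotset (sumset P P) (sumset B B)|%:R.
Proof.
move=> t0 B0 St tS tau8.
pose w := Num.max 1 tau.
have w1 : 1 <= w by rewrite le_max lexx.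
have w8 : w ^+ 8 <= t%:R by rewrite /w maxEle; case: ifP => // _; rewrite expr1n ler1n.
apply: (@le_trans _ _ (#|` S|%:R * t%:R * w)).
  by rewrite ler_wpM2l ?mulr_ge0// le_max lexx orbT.
pose M := Num.truncn (2 * w).
have /andP[Mle Mlt] : M%:R <= 2 * w < M.+1%:R by apply: truncn_itv; lra.
have M2 : (2 <= M)%N.
  by rewrite -ltnS -(ltr_nat R); move: Mlt w1; set q := _%:R; lra.
have wM : w <= M%:R by move: Mlt; rewrite -natr1; lra.
have M8 : (M ^ 8 <= 256 * t)%N.
  rewrite -(ler_nat R) natrX natrM; apply: (@le_trans _ _ ((2 * w) ^+ 8)).
    by rewrite lerXn2r ?nnegrE//; lra.
  by rewrite exprMn; lra.
have M6 : (M ^ 6 <= 64 * t)%N.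
  have : (2 ^ 2 <= M ^ 2)%N by rewrite leq_exp2r.
  by move: M8; rewrite (_ : M ^ 8 = M ^ 6 * M ^ 2)%N -?expnD//; nia.
have [MS|SM] := leqP M #|` S|.
  have := slopes_clusters B0 St M2 M6 MS.
  rewrite -(ler_nat R) !natrM; apply: le_trans.
  by rewrite mulrAC ler_wpM2r// ler_wpM2l.
have tM := leq_ltn_trans tS SM.
have M3 : (M < 3)%N.
  rewrite ltnNge; apply/negP => M3.
  have : (3 ^ 7 <= M ^ 7)%N by rewrite leq_exp2r.
  by move: M8; rewrite (expnSr M 7); nia.
have t1 : t = 1%N by lia.
have S1 : #|` S| = 1%N by lia.
have Z1 : (1 <= #|` quotset (sumset P P) (sumset B B)|)%N.
  have [l lS] : exists l, l \in S by apply/fset0Pn; rewrite -cardfs_eq0 S1.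
  have [x] : exists x, x \in line_fibre B P l.
    by apply/fset0Pn; rewrite -cardfs_eq0; have := St _ lS; lia.
  rewrite !inE => /andP[xB lxP].
  rewrite cardfs_gt0; apply/fset0Pn; exists ((l * x + l * x) / (x + x)).
  apply: in_imfset2; first exact: in_imfset2.
  by rewrite !inE in_imfset2//= gt_eqF// addr_gt0// B0.
have : 1 <= #|` quotset (sumset P P) (sumset B B)|%:R :> R by rewrite ler1n.
have : (M <= 2)%N by [].
rewrite -(ler_nat R) S1 t1; lra.
Qed.

(** * The number of slopes: Petridis and Ruzsa inequalities *)

Lemma prodsetP (R : realType) (A B : {fset R}) (x : R) :
  reflect (exists a b, [/\ a \in A, b \in B & x = a * b]) (x \in prodset A B).
Proof.
apply: (iffP (imfset2P _ _ _ _ _)) => [[a aA [b bB ->]]|[a [b [aA bB ->]]]].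
  by exists a, b.
by exists a => //; exists b.
Qed.

Lemma mem_prodset (R : realType) (A B : {fset R}) (a b : R) :
  a \in A -> b \in B -> a * b \in prodset A B.
Proof. by move=> aA bB; apply/prodsetP; exists a, b. Qed.

Lemma quotsetP (R : realType) (A B : {fset R}) (x : R) :
  reflect (exists a b, [/\ a \in A, b \in B, b != 0 & x = a / b]) (x \in quotset A B).
Proof.
apply: (iffP (imfset2P _ _ _ _ _)) => [[a aA [b]]|[a [b [aA bB b0 ->]]]].
  by rewrite !inE => /andP[bB b0] ->; exists a, b.
by exists a => //; exists b => //; rewrite !inE bB.
Qed.

Lemma prodset_subset (R : realType) (A A' B B' : {fset R}) :
  A `<=` A' -> B `<=` B' -> prodset A B `<=` prodset A' B'.
Proof.
move=> /fsubsetP sA /fsubsetP sB; apply/fsubsetP => x /prodsetP[a [b [aA bB ->]]].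
by rewrite mem_prodset ?sA ?sB.
Qed.

(** Petridis's inequality: if X has minimal expansion |YA|/|Y| among its subsets,
multiplying by any C preserves the expansion.  In the induction step, adding c to
C adds to XAC at most the translates z c of the z in XA outside X'A, where X' is
the set of x in X with x c already in XC; minimality of X applies to X'. *)
Lemma petridis (R : realType) (X A C : {fset R}) : 0 \notin C ->
  (forall Y, Y `<=` X ->
     (#|` prodset X A| * #|` Y| <= #|` prodset Y A| * #|` X|)%N) ->
  (#|` prodset (prodset X A) C| * #|` X| <= #|` prodset X A| * #|` prodset X C|)%N.
Proof.
move=> C0 Xmin; elim/fset1U_rect: C C0 => [|c C cC IH] C0.
  rewrite (_ : prodset (prodset X A) fset0 = fset0) ?cardfs0//.
  by apply/fsetP => x; rewrite inE; apply/prodsetP => -[a [b []]]; rewrite inE.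
have c0 : c != 0 by apply: contraNneq C0 => ->; rewrite fset1U1.
have {IH} : (#|` prodset (prodset X A) C| * #|` X| <=
    #|` prodset X A| * #|` prodset X C|)%N.
  by apply: IH; apply: contra C0 => ?; rewrite fset1Ur.
set XA := prodset X A; set XC := prodset X C; set XAC := prodset XA C => IH.
pose X' := [fset x in X | x * c \in XC].
pose V := [fset x in X | x * c \notin XC].
pose W := [fset z in XA | z * c \notin XAC].
have cX : (#|` V| + #|` X'| = #|` X|)%N.
  rewrite -[RHS](cardfsID X') addnC.
  have -> : X `&` X' = X' by apply/fsetP => x; rewrite !inE; case: (x \in X).
  suff -> : X `\` X' = V by [].
  by apply/fsetP => x; rewrite !inE; case: (x \in X); rewrite ?andbT ?andbF.
have disj : prodset X' A `<=` XA `\` W.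
  apply/fsubsetP => z /prodsetP[x [a [xX' aA ->]]].
  move: xX'; rewrite !inE => /andP[xX /prodsetP[y [d [yX dC e]]]].
  rewrite mem_prodset//= andbT negbK -mulrA (mulrC a) mulrA e.
  by rewrite mulrAC mem_prodset// mem_prodset.
have cW : (#|` W| + #|` prodset X' A| <= #|` XA|)%N.
  rewrite -(cardfsID W XA) leq_add//; last exact: fsubset_leq_card.
  by apply: fsubset_leq_card; apply/fsubsetP => z; rewrite !inE => /andP[-> ->].
have mulc_inj : injective (fun z : R => z * c) by apply: mulIf.
have up : (#|` prodset XA (c |` C)| <= #|` XAC| + #|` W|)%N.
  have -> : #|` W| = #|` [fset z * c | z in W]| by rewrite [RHS]card_imfset.
  rewrite -cardfsUI; apply: leq_trans (leq_addr _ _); apply: fsubset_leq_card.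
  apply/fsubsetP => z /prodsetP[y [d [yXA]]]; rewrite !inE => /orP[/eqP->|dC] ->; last first.
    by rewrite mem_prodset.
  have [//|nz] := boolP (y * c \in XAC).
  by apply/imfsetP; exists y => //; rewrite !inE yXA nz.
have lo : (#|` XC| + #|` V| <= #|` prodset X (c |` C)|)%N.
  have -> : #|` V| = #|` [fset x * c | x in V]| by rewrite [RHS]card_imfset.
  rewrite -cardfsUI (_ : XC `&` _ = fset0) ?cardfs0 ?addn0.
    apply: fsubset_leq_card; apply/fsubsetP => z; rewrite inE => /orP[|/imfsetP[x]].
      by apply/fsubsetP/prodset_subset => //; exact: fsubsetU1.
    by rewrite !inE => /andP[xX _] ->; rewrite mem_prodset// fset1U1.
  apply/fsetP => z; rewrite !inE; apply/negP => /andP[zXC /imfsetP[x]].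
  by rewrite !inE => /andP[_ /negP nx] ez; rewrite ez in zXC.
have := Xmin X'; have -> : X' `<=` X by apply/fsubsetP => x; rewrite !inE => /andP[].
move=> /(_ isT); rewrite -/XA => mn.
nia.
Qed.

(** Ruzsa's triangle inequality: fixing a representation q = y/w of each
quotient, (x, q) can be recovered from (x y, x w), since q is their ratio. *)
Lemma ruzsa_triangle (R : realType) (X Y W : {fset R}) : 0 \notin X -> 0 \notin W ->
  (#|` X| * #|` quotset Y W| <= #|` prodset X Y| * #|` prodset X W|)%N.
Proof.
move=> X0 W0.
have rep (q : quotset Y W) : exists z : R * R,
    [/\ z.1 \in Y, z.2 \in W, z.2 != 0 & fsval q = z.1 / z.2].
  by have /quotsetP[a [b h]] := fsvalP q; exists (a, b).
have [g gP] := choice rep.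
rewrite !cardfE -!card_prod.
have in1 (z : X * quotset Y W) : fsval z.1 * (g z.2).1 \in prodset X Y.
  by apply: mem_prodset; [exact: fsvalP|have [] := gP z.2].
have in2 (z : X * quotset Y W) : fsval z.1 * (g z.2).2 \in prodset X W.
  by apply: mem_prodset; [exact: fsvalP|have [] := gP z.2].
apply: (@leq_card _ _ (fun z => ([` in1 z], [` in2 z]))).
move=> [x q] [x' q'] /= [e1 e2].
have nz (y : X) : fsval y != 0.
  by apply: contraNneq X0 => <-; exact: fsvalP.
have eq : q = q'.
  apply: val_inj => /=; have [_ _ w0 ->] := gP q; have [_ _ w0' ->] := gP q'.
  rewrite -[LHS](mulKf (nz x)) -[RHS](mulKf (nz x')).
  transitivity ((fsval x * (g q).1) / (fsval x * (g q).2)).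
    by field; rewrite w0 nz.
  by rewrite e1 e2; field; rewrite w0' nz.
subst q'; congr (_, _); apply: val_inj => /=.
by have [_ _ w0 _] := gP q; apply: (mulIf w0).
Qed.

Lemma exists_min_expansion (R : realType) (A : {fset R}) : A != fset0 ->
  exists X : {fset R}, [/\ X != fset0, X `<=` A & forall Y, Y `<=` A ->
     (#|` prodset X A| * #|` Y| <= #|` prodset Y A| * #|` X|)%N].
Proof.
move=> A0.
have AA : A \in fpowerset A by rewrite fpowersetE.
pose F (Y : fpowerset A) : R := #|` prodset (val Y) A|%:R / #|` val Y|%:R.
have [] := @arg_minP _ _ _ [` AA] (fun Y => val Y != fset0) F A0.
move=> X X0 Xmin; exists (val X); split => //; first by rewrite -fpowersetE; exact: fsvalP.
move=> Y YA; have [->|Y0] := eqVneq Y fset0; first by rewrite cardfs0 muln0.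
have YP : Y \in fpowerset A by rewrite fpowersetE.
have := Xmin [` YP] Y0; rewrite /F/= ler_pdivrMr ?ltr0n ?cardfs_gt0// mulrAC.
rewrite ler_pdivlMr ?ltr0n ?cardfs_gt0//.
by rewrite -!natrM ler_nat.
Qed.

(** The Pluennecke-type bound |AA/B| <= K^3 |A| with K = |AA|/|A|.  For X in A of
minimal expansion, |XAA| |X| <= |XA|^2 by Petridis's inequality, and the triangle
inequality bounds |X| |AA/B| by |XAA| |XA|. *)
Lemma card_quot_prodset (R : realType) (A B : {fset R}) : 0 \notin A -> B `<=` A ->
  (#|` quotset (prodset A A) B| * #|` A| ^ 2 <= #|` prodset A A| ^ 3)%N.
Proof.
move=> A0 BA.
have [->|Ane] := eqVneq A fset0; first by rewrite cardfs0 muln0.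
have B0 : 0 \notin B by apply: contra A0; apply/fsubsetP.
have [X [Xne XA Xmin]] := exists_min_expansion Ane.
have X0 : 0 \notin X by apply: contra A0; apply/fsubsetP.
have h1 : (#|` prodset (prodset X A) A| * #|` X| <= #|` prodset X A| * #|` prodset X A|)%N.
  by apply: petridis => // Y YX; apply: Xmin; apply: fsubset_trans YX XA.
have h2 := ruzsa_triangle (prodset A A) X0 B0.
have assoc : prodset X (prodset A A) = prodset (prodset X A) A.
  apply/fsetP => z; apply/prodsetP/prodsetP => [[x [q [xX /prodsetP[a [b [aA bA ->]]] ->]]]|].
    by exists (x * a), b; rewrite mulrA mem_prodset.
  move=> [q [b [/prodsetP[x [a [xX aA ->]]] bA ->]]].
  by exists x, (a * b); rewrite mulrA mem_prodset.
have h3 : (#|` prodset X B| <= #|` prodset X A|)%N.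
  by apply: fsubset_leq_card; apply: prodset_subset.
have h4 := Xmin A (fsubset_refl _).
have h5 : (#|` X| <= #|` A|)%N by apply: fsubset_leq_card.
have x0 : (0 < #|` X|)%N by rewrite cardfs_gt0.
have a0 : (0 < #|` A|)%N by rewrite cardfs_gt0.
move: h1 h2 h3 h4 h5 x0 a0; rewrite assoc; clear.
move: #|` prodset (prodset X A) A| #|` prodset X A| #|` prodset X B|
  #|` prodset A A| #|` quotset _ _| #|` A| #|` X| => K U v p L n x.
move=> h1 h2 h3 h4 h5 x0 n0.
have g1 : (x * (x * L) <= U ^ 3)%N.
  apply: (@leq_trans (K * x * v)%N).
    by rewrite (_ : K * x * v = x * (K * v))%N; [rewrite leq_mul2l h2 orbT|ring].
  by rewrite (_ : U ^ 3 = U * U * U)%N; [exact: leq_mul|ring].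
have g2 : ((U * n) ^ 3 <= (p * x) ^ 3)%N by rewrite leq_exp2r.
have g3 : (x * (x * L) * n ^ 3 <= p ^ 3 * (x * x * n))%N.
  apply: (@leq_trans ((p * x) ^ 3)%N).
    by apply: leq_trans g2; rewrite expnMn leq_mul2r g1 orbT.
  by rewrite expnMn leq_mul2l; apply/orP; right; rewrite !expnS muln1 mulnA leq_mul2l h5 orbT.
rewrite -(@leq_pmul2r (x * x * n)) ?muln_gt0 ?x0 ?n0//.
by apply: leq_trans g3; rewrite (_ : L * n ^ 2 * (x * x * n) = x * (x * L) * n ^ 3)%N//; ring.
Qed.

(** * Summation over the richness of the slopes *)

Definition rich_slopes {R : realType} (B P : {fset R}) (t : nat) : {fset R} :=
  [fset l in quotset P B | (t <= #|` line_fibre B P l|)%N].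

(** Every point of B x P lies on a line whose slope is in P/B, so the numbers of
points of these lines add up to at least |P| |B|; the right-hand side is this sum,
written as a layer-cake sum over the richness. *)
Lemma card_pairs_le_rich (R : realType) (B P : {fset R}) :
  (forall x, x \in B -> x != 0) ->
  (#|` P| * #|` B| <= \sum_(t < #|` B|) #|` rich_slopes B P t.+1|)%N.
Proof.
move=> B0.
have cnt (S : {fset R}) (p : pred R) : (#|` [fset x in S | p x]| = \sum_(x <- S) p x)%N.
  by rewrite card_imfset//= size_filter -sum1_count big_mkcond/=;
     apply: eq_bigr => x _; case: (p x).
have fib l : (#|` line_fibre B P l| = \sum_(t < #|` B|) (t < #|` line_fibre B P l|))%N.
  have le : (#|` line_fibre B P l| <= #|` B|)%N.
    by apply: fsubset_leq_card; apply/fsubsetP => x; rewrite !inE => /andP[].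
  transitivity (\sum_(t < #|` B| | (t < #|` line_fibre B P l|)%N) 1)%N.
    by rewrite -(big_ord_widen _ (fun=> 1%N) le) sum1_card card_ord.
  by rewrite big_mkcond/=; apply: eq_bigr => t _; case: ltnP.
have -> : (\sum_(t < #|` B|) #|` rich_slopes B P t.+1| =
    \sum_(l <- quotset P B) #|` line_fibre B P l|)%N.
  under [LHS]eq_bigr do rewrite cnt.
  by rewrite exchange_big/=; apply: eq_bigr => l _; rewrite [RHS]fib.
under eq_bigr do rewrite cnt.
rewrite exchange_big/= -[X in (_ * X)%N]sum1_size big_distrr/= [leqLHS]big_seq [leqRHS]big_seq.
apply: leq_sum => x xB; rewrite muln1 -cnt.
have xI : injective (fun p : R => p / x) by apply: mulIf; rewrite invr_neq0// B0.
have -> : #|` P| = #|` [fset p / x | p in P]| by rewrite [RHS]card_imfset.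
apply: fsubset_leq_card; apply/fsubsetP => l /imfsetP[p /= pP ->].
rewrite !inE divfK ?B0// pP andbT.
by apply/quotsetP; exists p, x; rewrite B0.
Qed.

Lemma harmonic_le_ln (R : realType) (n : nat) : (0 < n)%N ->
  \sum_(t < n) (t.+1%:R : R)^-1 <= 1 + ln (n%:R : R).
Proof.
elim: n => // -[_ _|n IH _]; first by rewrite big_ord1 ln1 addr0 invr1.
rewrite big_ord_recr/=; have := IH isT.
suff : (n.+2%:R : R)^-1 <= ln (n.+2%:R : R) - ln (n.+1%:R : R).
  by move=> step /lerD/(_ step)/le_trans; apply; rewrite -addrA subrKC.
have p1 : 0 < n.+1%:R :> R by rewrite ltr0n.
have p2 : 0 < n.+2%:R :> R by rewrite ltr0n.
have := @le_ln1Dx R (- (n.+2%:R)^-1).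
have -> : 1 + - (n.+2%:R)^-1 = n.+1%:R / n.+2%:R :> R.
  apply: (mulIf (lt0r_neq0 p2)); rewrite mulfVK ?lt0r_neq0// mulrDl mulNr.
  rewrite mulVf ?lt0r_neq0// -[in RHS]natr1 -natr1; ring.
rewrite ln_div// => H; have : -1 < - (n.+2%:R)^-1 :> R.
  by rewrite ltrN2 invf_lt1// ltr1n.
by move/H; rewrite lerNr opprB.
Qed.

(** The parameters q = N^(1/8) and r = P^(1/4) keep the computation free of real
exponents: the left-hand side is N^(11/8) P^(3/4).  Every S_t with t <= |B|
contains A, because the line of slope a in A carries all the points of abscissa
in B; this gives the hypothesis t <= |S_t| of [slopes_growth]. *)
Lemma AAAA_growth_pos (R : realType) : exists2 K : R, 0 <= K &
  forall (A : {fset R}) (q r : R),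
  0 \notin A -> A != fset0 -> (#|` A| <= 2 * #|` [fset x in A | (0 < x)%R]|)%N ->
  0 < q -> 0 < r -> q ^+ 8 = #|` A|%:R -> r ^+ 4 = #|` prodset A A|%:R ->
  q ^+ 11 * r ^+ 3 <= K * #|` AAAAoverAA A|%:R * (1 + ln (#|` A|%:R : R)).
Proof.
have [K [K0 KE]] : exists K : R, 0 <= K /\ K = 1080.
  by exists 1080; split; [exact: ler0n|exact: erefl].
exists (8 * K); first exact: mulr_ge0.
move=> A q r A0 Ane; set B := [fset x in A | 0 < x] => AB q0 r0 qA rP.
set P := prodset A A; set L := quotset P B; set Z := AAAAoverAA A.
have Bpos x : x \in B -> 0 < x by rewrite !inE => /andP[].
have BA : B `<=` A by apply/fsubsetP => x; rewrite !inE => /andP[].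
have n0 : (0 < #|` A|)%N by rewrite cardfs_gt0.
have b0 : (0 < #|` B|)%N by lia.
have bA := fsubset_leq_card BA.
have [x0 x0B] : exists x, x \in B by apply/fset0Pn; rewrite -cardfs_gt0.
have AL : A `<=` L.
  apply/fsubsetP => a aA; apply/quotsetP; exists (a * x0), x0.
  have x00 : x0 != 0 by rewrite gt_eqF ?Bpos.
  by split; rewrite ?mulfK//; apply: mem_prodset => //; exact: (fsubsetP BA).
have l0 : (0 < #|` L|)%N by apply: leq_trans n0 (fsubset_leq_card AL).
have pR : 0 < #|` P|%:R :> R by rewrite -rP exprn_gt0.
have lR : 0 < #|` L|%:R :> R by rewrite ltr0n.
have bR : 0 < #|` B|%:R :> R by rewrite ltr0n.
have nR : 0 < #|` A|%:R :> R by rewrite ltr0n.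
(* Below the threshold t0, the trivial bound |S_t| <= |L| is good enough. *)
have [t0 t0p t0L] : exists2 t0 : R, 0 < t0 &
    t0 * #|` L|%:R = #|` P|%:R * #|` B|%:R / 2.
  exists (#|` P|%:R * #|` B|%:R / 2 / #|` L|%:R); last by rewrite divfK ?gt_eqF.
  by rewrite !divr_gt0 ?mulr_gt0.
have [w w0 w8] : exists2 w : R, 0 < w & w ^+ 8 = t0.
  exists (t0 `^ (8%:R^-1)); first by rewrite powR_gt0.
  by rewrite -powR_mulrn ?powR_ge0// -powRrM mulVf ?powRr1// ltW.
have ZB : (#|` quotset (sumset P P) (sumset B B)| <= #|` Z|)%N.
  apply: fsubset_leq_card; apply/fsubsetP => z /quotsetP[s [d [sS]]].
  case/imfset2P => x xB [y yB ->] d0 ->; apply/quotsetP; exists s, (x + y).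
  by split => //; apply: in_imfset2; exact: (fsubsetP BA).
have rich (t : 'I_#|` B|) : #|` rich_slopes B P t.+1|%:R * t.+1%:R * w <= K * #|` Z|%:R
    \/ t.+1%:R < t0.
  have [tt0|] := leP t0 t.+1%:R; [left|by right].
  apply: (@le_trans _ _ (K * #|` quotset (sumset P P) (sumset B B)|%:R)); last first.
    by rewrite ler_wpM2l// ler_nat.
  have rS l : l \in rich_slopes B P t.+1 -> (t.+1 <= #|` line_fibre B P l|)%N.
    by rewrite !inE => /andP[].
  have cS : (t.+1 <= #|` rich_slopes B P t.+1|)%N.
    apply: (@leq_trans #|` A|); first by apply: leq_trans bA.
    apply: fsubset_leq_card; apply/fsubsetP => a aA; rewrite !inE (fsubsetP AL)//=.
    rewrite (_ : line_fibre B P a = B); first exact: ltn_ord.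
    apply/fsetP => x; rewrite !inE; apply/andP/idP => [[]//|/andP[xA xp]].
    by rewrite xA xp; split=> //; apply: mem_prodset.
  have w8t : w ^+ 8 <= t.+1%:R by rewrite w8.
  rewrite KE; exact: (slopes_growth (ltn0Sn t) Bpos rS cS w8t).
have each (t : 'I_#|` B|) : #|` rich_slopes B P t.+1|%:R <=
    (if t.+1%:R < t0 then #|` L|%:R else 0) + K * #|` Z|%:R / w * (t.+1%:R)^-1 :> R.
  have tp : 0 < t.+1%:R :> R by rewrite ltr0n.
  have nn : 0 <= K * #|` Z|%:R / w * (t.+1%:R)^-1 :> R.
    by rewrite !mulr_ge0// ?invr_ge0// ltW.
  case: ltP => [_|tt0].
    apply: ler_wpDr => //; rewrite ler_nat; apply: fsubset_leq_card.
    by apply/fsubsetP => l; rewrite !inE => /andP[].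
  rewrite add0r ler_pdivlMr// ler_pdivlMr//.
  by case: (rich t) => //; rewrite ltNge tt0.
have low : \sum_(t < #|` B|) (if t.+1%:R < t0 then #|` L|%:R else 0) <=
    t0 * #|` L|%:R :> R.
  rewrite -big_mkcond/= sumr_const -[X in X <= _]mulr_natl ler_wpM2r//.
  have tr := truncn_itv (ltW t0p).
  apply: (@le_trans _ _ (Num.truncn t0)%:R); last by have /andP[] := tr.
  rewrite ler_nat.
  have tb (t : 'I_#|` B|) : t.+1%:R < t0 -> (t < Num.truncn t0)%N.
    move=> h; have /andP[_ h2] := tr.
    by rewrite -ltnS -(ltr_nat R); apply: lt_trans h h2.
  have [T0|T0] := posnP (Num.truncn t0).
    by rewrite eq_card0// => t; apply/negP => /tb; rewrite T0.
  apply: leq_trans (card_block #|` B| 0 T0).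
  rewrite -sum1_card big_mkcond/=; apply: leq_sum => t _.
  by case: ifP => // /tb tT; rewrite divn_small.
have tot : #|` P|%:R * #|` B|%:R <= t0 * #|` L|%:R +
    K * #|` Z|%:R / w * (1 + ln (#|` A|%:R : R)).
  apply: (@le_trans _ _ (\sum_(t < #|` B|) #|` rich_slopes B P t.+1|%:R)).
    rewrite -natrM -natr_sum ler_nat; apply: card_pairs_le_rich => x xB.
    by rewrite gt_eqF ?Bpos.
  apply: le_trans (ler_sum _ (fun t _ => each t)) _.
  rewrite big_split/= lerD// -mulr_sumr ler_wpM2l//.
    by rewrite !mulr_ge0// invr_ge0 ltW.
  apply: le_trans (harmonic_le_ln _ b0) _.
  by rewrite lerD2l ler_ln ?posrE// ler_nat.
have main : #|` P|%:R * #|` B|%:R / 2 * w <= K * #|` Z|%:R * (1 + ln (#|` A|%:R : R)).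
  rewrite -ler_pdivlMr// mulrAC; lra.
have AB' : #|` A|%:R <= 2 * #|` B|%:R :> R by rewrite -natrM ler_nat.
have LP : #|` L|%:R * #|` A|%:R ^+ 2 <= #|` P|%:R ^+ 3 :> R.
  by rewrite -!natrX -natrM ler_nat; apply: card_quot_prodset.
(* This is t0 >= N^3/(4 P^2), up to the constant. *)
have wlow : q ^+ 3 / (2 * r) <= w.
  rewrite -(@ler_pXn2r _ 8)// ?nnegrE ?(ltW w0) ?divr_ge0 ?exprn_ge0 ?mulr_ge0 ?(ltW q0) ?(ltW r0)//.
  rewrite w8 expr_div_n -exprM exprMn ler_pdivrMr ?mulr_gt0 ?exprn_gt0//.
  have -> : q ^+ (3 * 8) = #|` A|%:R ^+ 3 by rewrite -qA -exprM.
  have -> : r ^+ 8 = #|` P|%:R ^+ 2 by rewrite -rP -exprM.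
  rewrite -(ler_pM2r lR).
  have -> : t0 * (2 ^+ 8 * #|` P|%:R ^+ 2) * #|` L|%:R =
      128 * #|` P|%:R ^+ 3 * #|` B|%:R :> R.
    by rewrite mulrAC t0L; field.
  apply: (@le_trans _ _ (#|` A|%:R * #|` P|%:R ^+ 3)).
    by rewrite exprS -mulrA ler_pM2l// mulrC.
  apply: (@le_trans _ _ (2 * #|` B|%:R * #|` P|%:R ^+ 3)).
    by rewrite ler_pM2r// exprn_gt0.
  have : 0 <= #|` P|%:R ^+ 3 * #|` B|%:R :> R by rewrite mulr_ge0// exprn_ge0.
  lra.
have : q ^+ 11 * r ^+ 3 <= 8 * (#|` P|%:R * #|` B|%:R / 2 * w).
  apply: (@le_trans _ _ (2 * (#|` P|%:R * #|` A|%:R * w))); last first.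
    have : #|` P|%:R * w * #|` A|%:R <= #|` P|%:R * w * (2 * #|` B|%:R) :> R.
      by rewrite ler_pM2l// mulr_gt0.
    lra.
  apply: (@le_trans _ _ (2 * (#|` P|%:R * #|` A|%:R * (q ^+ 3 / (2 * r))))).
    rewrite -qA -rP le_eqVlt; apply/orP; left; apply/eqP.
    by field; rewrite gt_eqF.
  by rewrite ler_pM2l// ler_pM2l// mulr_gt0.
by move=> /le_trans; apply; rewrite -!(mulrA 8) ler_pM2l.
Qed.

Lemma prodset_opp (R : realType) (A : {fset R}) :
  prodset [fset - x | x in A] [fset - x | x in A] = prodset A A.
Proof.
apply/fsetP => z; apply/prodsetP/prodsetP.
  move=> [_ [_ [/imfsetP[a /= aA ->] /imfsetP[b /= bA ->] ->]]].
  by exists a, b; rewrite mulrNN.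
move=> [a [b [aA bA ->]]]; exists (- a), (- b); rewrite mulrNN; split=> //.
  by apply/imfsetP; exists a.
by apply/imfsetP; exists b.
Qed.

Lemma card_AAAA_opp (R : realType) (A : {fset R}) :
  (#|` AAAAoverAA [fset (- x)%R | x in A]| <= #|` AAAAoverAA A|)%N.
Proof.
have -> : #|` AAAAoverAA A| = #|` [fset (- x)%R | x in AAAAoverAA A]|.
  by rewrite [RHS]card_imfset//; exact: oppr_inj.
apply: fsubset_leq_card; apply/fsubsetP => z; rewrite /AAAAoverAA prodset_opp.
case/quotsetP => s [d [sP /imfset2P[_ /imfsetP[a /= aA ->]]]].
case=> _ /imfsetP[b /= bA ->] -> d0 ->.
rewrite -opprD in d0 *; rewrite invrN mulrN; apply/imfsetP.
exists (s / (a + b)) => //; apply/quotsetP; exists s, (a + b).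
by rewrite oppr_eq0 in d0; split=> //; exact: in_imfset2.
Qed.

(** The set Z changes sign with A while AA does not change, so A may be replaced
by -A if most of its elements are negative. *)
Lemma AAAA_growth_nonzero (R : realType) : exists2 K : R, 0 <= K &
  forall (A : {fset R}) (q r : R),
  0 \notin A -> A != fset0 ->
  0 < q -> 0 < r -> q ^+ 8 = #|` A|%:R -> r ^+ 4 = #|` prodset A A|%:R ->
  q ^+ 11 * r ^+ 3 <= K * #|` AAAAoverAA A|%:R * (1 + ln (#|` A|%:R : R)).
Proof.
have [K K0 growth] := AAAA_growth_pos R; exists K => // A q r A0 Ane q0 r0 qA rP.
have cN : #|` [fset (- x)%R | x in A]| = #|` A| by rewrite [LHS]card_imfset//; exact: oppr_inj.
have [AB|BA] := leqP #|` A| (2 * #|` [fset x in A | (0 < x)%R]|)%N.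
  exact: growth.
have N0 : 0 \notin [fset (- x)%R | x in A].
  by apply: contra A0 => /imfsetP[x /= xA /esym/eqP]; rewrite oppr_eq0 => /eqP <-.
have Nne : [fset (- x)%R | x in A] != fset0 by rewrite -cardfs_gt0 cN cardfs_gt0.
have NB : (#|` [fset (- x)%R | x in A]| <=
    2 * #|` [fset x in [fset (- x)%R | x in A] | (0 < x)%R]|)%N.
  rewrite cN; set N := [fset x in [fset (- x)%R | x in A] | (0 < x)%R].
  suff : (#|` A| <= #|` [fset x in A | (0 < x)%R]| + #|` N|)%N by lia.
  have -> : #|` N| = #|` [fset (- x)%R | x in N]|.
    by rewrite [RHS]card_imfset//; exact: oppr_inj.
  rewrite -cardfsUI; apply: leq_trans (leq_addr _ _); apply: fsubset_leq_card.
  apply/fsubsetP => x xA; rewrite !inE xA /=.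
  have x0 : x != 0 by apply: contraNneq A0 => <-.
  case: ltgtP x0 => //= x0 _; apply/imfsetP; exists (- x); rewrite ?opprK//=.
  by rewrite !inE/= oppr_gt0 x0 andbT; apply/imfsetP; exists x.
have := growth _ _ _ N0 Nne NB q0 r0; rewrite cN prodset_opp => /(_ qA rP)/le_trans; apply.
rewrite ler_wpM2r ?addr_ge0 ?ln_ge0 ?ler1n ?cardfs_gt0//.
by rewrite ler_wpM2l ?ler_nat ?card_AAAA_opp// mulr_ge0.
Qed.

(** Removing 0 from A costs at most one element of A and one of AA, hence at most
a factor 2 for each cardinal; 8 = 2^2 * 2^1 bounds 2^(11/8) * 2^(3/4). *)
Lemma card_AAAA_lower (R : realType) : exists2 K : R, 0 <= K &
  forall A : {fset R}, (2 <= #|` A|)%N ->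
  #|` A|%:R `^ (11 / 8) * #|` prodset A A|%:R `^ (3 / 4) <=
  K * #|` AAAAoverAA A|%:R * (1 + ln (#|` A|%:R : R)) :> R.
Proof.
have [K K0 growth] := AAAA_growth_nonzero R.
exists (8 * K); [exact: mulr_ge0|move=> A A2]; pose A' := A `\ 0.
have A'0 : 0 \notin A' by rewrite !inE eqxx.
have sA : A' `<=` A by exact: fsubsetDl.
have cA : (#|` A| <= #|` A'|.+1)%N by rewrite (cardfsD1 0 A) -add1n leq_add2r leq_b1.
have cA' : (#|` A| <= 2 * #|` A'|)%N by lia.
have A'ne : A' != fset0 by rewrite -cardfs_gt0; lia.
have cP : (#|` prodset A A| <= #|` prodset A' A'|.+1)%N.
  apply: (@leq_trans #|` 0 |` prodset A' A'|); last first.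
    by rewrite cardfsU1 -add1n leq_add2r leq_b1.
  apply: fsubset_leq_card; apply/fsubsetP => z /prodsetP[a [b [aA bA ->]]].
  rewrite !inE mulf_eq0; have [//|a0] := eqVneq a 0; have [//|b0] := eqVneq b 0.
  by rewrite mem_prodset// !inE ?a0 ?b0.
have [a aA'] : exists a, a \in A' by apply/fset0Pn.
have P'0 : (0 < #|` prodset A' A'|)%N.
  by rewrite cardfs_gt0; apply/fset0Pn; exists (a * a); exact: mem_prodset.
have cP' : (#|` prodset A A| <= 2 * #|` prodset A' A'|)%N by lia.
have ZZ : (#|` AAAAoverAA A'| <= #|` AAAAoverAA A|)%N.
  have sP := prodset_subset sA sA.
  apply: fsubset_leq_card; apply/fsubsetP => z /quotsetP[s [d []]].
  case/imfset2P => x xP [y yP ->] /imfset2P[u uA [v vA ->]] d0 ->.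
  apply/quotsetP; exists (x + y), (u + v).
  by split => //; apply: in_imfset2; rewrite ?(fsubsetP sP)// (fsubsetP sA).
have n0 : 0 < #|` A'|%:R :> R by rewrite ltr0n cardfs_gt0.
have p0 : 0 < #|` prodset A' A'|%:R :> R by rewrite ltr0n.
pose q : R := #|` A'|%:R `^ (8^-1); pose r : R := #|` prodset A' A'|%:R `^ (4^-1).
have qE k : q ^+ k = #|` A'|%:R `^ (k%:R / 8).
  by rewrite -powR_mulrn ?powR_ge0// -powRrM mulrC.
have rE k : r ^+ k = #|` prodset A' A'|%:R `^ (k%:R / 4).
  by rewrite -powR_mulrn ?powR_ge0// -powRrM mulrC.
have q8 : q ^+ 8 = #|` A'|%:R by rewrite qE divff// powRr1// ltW.
have r4 : r ^+ 4 = #|` prodset A' A'|%:R by rewrite rE divff// powRr1// ltW.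
have := growth _ _ _ A'0 A'ne (powR_gt0 _ n0) (powR_gt0 _ p0) q8 r4.
rewrite -/q -/r qE rE => G.
have two (e : R) (k : nat) : e <= k%:R -> 2 `^ e <= 2 ^+ k :> R.
  by move=> ek; rewrite -powR_mulrn//; apply: ler_powR => //; rewrite ler1n.
have pw (x y e : R) : 0 <= e -> 0 <= x -> 0 <= y -> x <= 2 * y -> x `^ e <= 2 `^ e * y `^ e.
  move=> e0 x0 y0 xy; rewrite -powRM//.
  by apply: ge0_ler_powR; rewrite ?nnegrE// mulr_ge0.
apply: (@le_trans _ _ (8 * (#|` A'|%:R `^ (11 / 8) * #|` prodset A' A'|%:R `^ (3 / 4)))).
  rewrite [leRHS](_ : _ = (2 ^+ 2 * #|` A'|%:R `^ (11 / 8)) *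
    (2 ^+ 1 * #|` prodset A' A'|%:R `^ (3 / 4))); last by ring.
  apply: ler_pM; rewrite ?powR_ge0//.
    apply: le_trans (pw _ #|` A'|%:R _ _ _ _ _) _ => //; rewrite -?natrM ?ler_nat//.
    by rewrite ler_wpM2r ?powR_ge0// two//; lra.
  apply: le_trans (pw _ #|` prodset A' A'|%:R _ _ _ _ _) _ => //; rewrite -?natrM ?ler_nat//.
  by rewrite ler_wpM2r ?powR_ge0// two//; lra.
rewrite -!(mulrA 8) ler_pM2l//; apply: le_trans G _.
apply: ler_pM; rewrite ?mulr_ge0 ?addr_ge0 ?ln_ge0 ?ler1n ?cardfs_gt0//.
  by rewrite ler_wpM2l ?ler_nat// mulr_ge0.
have A0 : (0 < #|` A|)%N by lia.
by rewrite lerD2l ler_ln ?posrE// ?ltr0n// ler_nat; exact: fsubset_leq_card.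
Qed.

Lemma ln_le_log2 (R : realType) (x : R) : 2 <= x -> 1 + ln x <= 2 * log2 x.
Proof.
move=> x2; have l2 : 0 < ln 2 :> R by rewrite ln_gt0// ltr1n.
have l21 : ln 2 <= 1 :> R by have := @le_ln1Dx R 1; rewrite -[1 + 1]/2; apply; lra.
have lx : ln x = log2 x * ln 2 by rewrite /log2 divfK ?gt_eqF.
have g1 : 1 <= log2 x by rewrite ler_pdivlMr// mul1r ler_ln ?posrE//; lra.
rewrite lx mulr_natl mulr2n lerD// ler_piMr//; lra.
Qed.

Lemma card_le_prodset (R : realType) (A : {fset R}) : (2 <= #|` A|)%N ->
  (#|` A| <= #|` prodset A A|)%N.
Proof.
move=> A2; have [a aA0] : exists a, a \in A `\ 0.
  by apply/fset0Pn; rewrite -cardfs_gt0 -ltnS; apply: leq_trans A2 _;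
     rewrite (cardfsD1 0 A) -add1n leq_add2r leq_b1.
move: aA0; rewrite !inE => /andP[a0 aA].
have -> : #|` A| = #|` [fset a * x | x in A]| by rewrite [RHS]card_imfset//; exact: mulfI.
by apply: fsubset_leq_card; apply/fsubsetP => _ /imfsetP[x /= xA ->]; exact: mem_prodset.
Qed.

Theorem theorem1p4 (R : realType) :
  (exists c : R, 0 < c /\
     forall A : {fset R}, (2 <= #|` A|)%N ->
       c * ((#|` A|%:R `^ (11 / 8) * #|` prodset A A|%:R `^ (3 / 4))
            / log2 (#|` A|%:R))
       <= #|` AAAAoverAA A|%:R) /\
  (exists c : R, 0 < c /\
     forall A : {fset R}, (2 <= #|` A|)%N ->
       c * (#|` A|%:R `^ (2 + 1 / 8) / log2 (#|` A|%:R))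
       <= #|` AAAAoverAA A|%:R).
Proof.
have [K K0 growth] := card_AAAA_lower R.
pose c : R := (2 * K + 1)^-1.
have c0 : 0 < c by rewrite invr_gt0; lra.
have log0 (A : {fset R}) : (2 <= #|` A|)%N -> 0 < log2 (#|` A|%:R : R).
  by move=> A2; rewrite divr_gt0// ln_gt0// ltr1n.
have bound (A : {fset R}) : (2 <= #|` A|)%N ->
    c * ((#|` A|%:R `^ (11 / 8) * #|` prodset A A|%:R `^ (3 / 4)) / log2 (#|` A|%:R))
    <= #|` AAAAoverAA A|%:R.
  move=> A2; rewrite mulrC ler_pdivrMr; last by lra.
  rewrite ler_pdivrMr ?log0//; apply: le_trans (growth _ A2) _.
  have A2R : 2 <= #|` A|%:R :> R by rewrite ler_nat.
  have Z0 : 0 <= #|` AAAAoverAA A|%:R :> R by rewrite ler0n.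
  apply: (@le_trans _ _ (K * #|` AAAAoverAA A|%:R * (2 * log2 (#|` A|%:R : R)))).
    by rewrite ler_wpM2l ?mulr_ge0// ln_le_log2.
  have : 0 <= #|` AAAAoverAA A|%:R * log2 (#|` A|%:R : R).
    by rewrite mulr_ge0// ltW ?log0.
  lra.
split; exists c; split=> //; move=> A A2.
apply: le_trans (bound A A2).
rewrite ler_pM2l// ler_pM2r ?invr_gt0 ?log0//.
have n0 : 0 < #|` A|%:R :> R by rewrite ltr0n; lia.
have -> : 2 + 1 / 8 = 11 / 8 + 3 / 4 :> R by lra.
rewrite powRD ?gt_eqF ?implybT// ler_pM2l ?powR_gt0//.
by apply: ge0_ler_powR; rewrite ?nnegrE// ?ler_nat ?card_le_prodset.
Qed.
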